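(* Let $c>c^*$ and let $(\rho,\varrho)$ be a positive solution of $$\begin{cases}\displaystyle\rho(\xi+c)=\int_{\mathbb R}\frac{(1+d_1)\rho(\xi-y)}{1+d_1\big(\rho(\xi-y)+b_1\rho(\xi-y-c)+a_1\varrho(\xi-y)\big)}k_1(y)\,dy,\\[2mm] \displaystyle\varrho(\xi+c)=\int_{\mathbb R}\frac{(1+d_2)\varrho(\xi-y)}{1+d_2\big(\varrho(\xi-y)+b_2\varrho(\xi-y-c)+a_2\rho(\xi-y)\big)}k_2(y)\,dy,\end{cases}\qquad \xi\in\mathbb R,$$ with $0<\rho(\xi)<1$ and $0<\varrho(\xi)<1$ for all $\xi\in\mathbb R$. If $a_1+b_1<1$ and $a_2+b_2<1$, then $$\lim_{\xi\to+\infty}(\rho(\xi),\varrho(\xi))=(p^*,q^* ).$$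
   Context: Solutions are bounded uniformly continuous functions $\mathbb R\to\mathbb R^2$. All parameters $a_1,a_2,b_1,b_2,d_1,d_2$ are nonnegative, and $d_1>0$, $d_2>0$, $1+b_1>a_2$, $1+b_2>a_1$. For $i=1,2$, the kernel $k_i:\mathbb R\to[0,\infty)$ is Lebesgue measurable and integrable, even ($k_i(x)=k_i(-x)$), with $\int_{\mathbb R}k_i(y)\,dy=1$ and $\int_{\mathbb R}k_i(y)e^{\lambda y}dy<\infty$ for every $\lambda\ge0$. Define $$c^*=\max_{i=1,2}\ \inf_{\lambda>0}\frac{\ln\left((1+d_i)\int_{\mathbb R}e^{\lambda y}k_i(y)\,dy\right)}{\lambda},$$ $$(p^*,q^* )=\left(\frac{1+b_2-a_1}{(1+b_1)(1+b_2)-a_1a_2},\ \frac{1+b_1-a_2}{(1+b_1)(1+b_2)-a_1a_2}\right).$$ *)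

(* Defs.v *)
From mathcomp Require Import all_boot all_order all_algebra.
From mathcomp Require Import all_classical all_reals all_analysis.
Import Order.TTheory GRing.Theory Num.Theory.
Import numFieldNormedType.Exports.

Set Implicit Arguments.
Unset Strict Implicit.
Unset Printing Implicit Defensive.

Local Open Scope classical_set_scope.
Local Open Scope ring_scope.

(* The real line with the sigma-algebra of Lebesgue (not only Borel) measurable
   sets, i.e. the Caratheodory-measurable sets of the Lebesgue outer measure;
   its carrier is convertible to R. *)
Notation leb_line R :=
  (caratheodory_type ((@wlength R idfun)^*)%mu).

Notation leb R := (@completed_lebesgue_measure R).

Definition bounded_unif_continuous (R : realType) (V : normedModType R)
    (f : R -> V) : Prop :=
  bounded_fun f /\ unif_continuous f.

Record dispersal_kernel (R : realType) (k : R -> R) : Prop := {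
  kernel_measurable : measurable_fun [set: leb_line R] (k : leb_line R -> R) ;
  kernel_integrable : (leb R).-integrable setT (EFin \o k) ;
  kernel_ge0 : forall x, 0 <= k x ;
  kernel_even : forall x, k x = k (- x) ;
  kernel_mass1 : (\int[leb R]_y (k y)%:E = 1)%E ;
  kernel_exp_moment : forall lambda : R, 0 <= lambda ->
    (\int[leb R]_y (k y * expR (lambda * y))%:E < +oo)%E }.

(* The infimum is taken in R: for a dispersal kernel and d > 0 the set is
   nonempty and bounded below by 0, so [inf] is not a default value. *)
Definition linear_speed (R : realType) (d : R) (k : R -> R) : R :=
  inf [set ln ((1 + d) * \int[leb R]_y (expR (lambda * y) * k y)) / lambda
      | lambda in [set lambda : R | 0 < lambda]].

Definition cstar (R : realType) (d1 d2 : R) (k1 k2 : R -> R) : R :=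
  Num.max (linear_speed d1 k1) (linear_speed d2 k2).

Definition pstar (R : realType) (a1 a2 b1 b2 : R) : R :=
  (1 + b2 - a1) / ((1 + b1) * (1 + b2) - a1 * a2).

Definition qstar (R : realType) (a1 a2 b1 b2 : R) : R :=
  (1 + b1 - a2) / ((1 + b1) * (1 + b2) - a1 * a2).

(* One equation of the wave system: [u] is the species considered, [v] its
   competitor.  The integral is extended-real valued, so the equality includes
   its finiteness. *)
Definition wave_equation (R : realType) (d a b : R) (k : R -> R) (c : R)
    (u v : R -> R) : Prop :=
  forall xi : R,
    (u (xi + c))%:E =
    (\int[leb R]_y
       ((1 + d) * u (xi - y) /
          (1 + d * (u (xi - y) + b * u (xi - y - c) + a * v (xi - y)))
        * k y)%:E)%E.

(* Main.v *)
Require Import Defs.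
From mathcomp Require Import all_boot all_order all_algebra.
From mathcomp Require Import all_classical all_reals all_analysis.
From mathcomp Require Import measurable_realfun ring lra.
Import Order.TTheory GRing.Theory Num.Theory.
Import numFieldNormedType.Exports.

(** Why the profile converges.  Let [h1], [l1] be the upper and lower limits of
    [rho] at +oo, and [h2], [l2] those of [varrho].  The density after
    reproduction increases with the present density of the species and decreases
    with its delayed density and with that of the competitor, so passing to the
    limit in the wave equation gives
      h1 <= (1 + d1) h1 / (1 + d1 (h1 + b1 l1 + a1 l2)),
    that is h1 + b1 l1 + a1 l2 <= 1 (lemma [wave_sup_le]), and dually
    1 <= l1 + b1 h1 + a1 h2 (lemma [wave_inf_ge]), both divisions being allowed
    when l1 > 0.  Together with the same two inequalities for [varrho], the
    conditions a_i + b_i < 1 make this system contracting: the oscillations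
    h_i - l_i vanish and the common limits solve the linear system whose solution is the
    coexistence state ([contracting_rectangle]).

    The remaining point is persistence, l1 > 0 and l2 > 0
    ([wave_bounded_below]).  As the delayed and competing densities stay below
    1, a species at low density is multiplied before dispersal by at least
    1 / theta, for some theta < 1.  Dispersal by an even kernel hardly diminishes a
    wide enough tent function: the mean of [tent L] around any point [x] is at
    least theta * tent L x ([kernel_mean_tent]).  So a small multiple of the
    tent which lies below [rho] at time 0 stays below [x |-> rho (x + n c)] for
    every [n].  Because c > 0, every xi >= 0 has the form x + n c with
    0 <= x < c, where the tent is bounded away from 0.  That c > 0 follows from
    c > cstar: both linear speeds are nonnegative, since an even kernel satisfies
    mean (exp (lambda y)) = mean (cosh (lambda y)) >= 1 ([linear_speed_ge0]).

    Evenness of the kernels enters through the invariance of the completed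
    Lebesgue measure under y |-> - y.  The tails of the kernels are controlled
    by the first exponential moment alone, using y <= exp y. *)

Local Open Scope classical_set_scope.
Local Open Scope ring_scope.

(** * Reflection invariance of the completed Lebesgue measure *)

Section Reflection.
Context {R : realType}.
Local Open Scope ereal_scope.

(** An interval of the form ]a, b] is reflected onto [-b, -a[, which is no longer
    one of the covering sets but has the same measure; hence reflecting a cover
    of [A] termwise gives a family covering the reflected set at the same cost. *)
Lemma leb_reflection_le (A : set R) :
  leb R ((fun x : R => (- x)%R) @^-1` A) <= leb R A.
Proof.
apply: le_ereal_inf_tmp => _ [B [mB AB] <-].
pose N (X : set R) := (fun x : R => (- x)%R) @^-1` X.
have sub : N A `<=` \bigcup_k N (B k).
  by move=> x /AB [k _ Bk]; exists k.
apply: le_trans (le_outer_measure (wlength idfun)^*%mu _ _ sub) _.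
apply: le_trans (outer_measure_sigma_subadditive (wlength idfun)^*%mu _) _.
apply: lee_nneseries => // k _.
have [[a b] _ Bk] := mB k.
rewrite -[leRHS](measurable_mu_extE (wlength idfun) (mB k)).
rewrite -[leLHS]/(lebesgue_measure (N (B k))).
rewrite -[leRHS]/(lebesgue_measure (B k)) -Bk /=.
have -> : N `]a, b]%classic = `[(- b)%R, (- a)%R[%classic.
  by apply/seteqP; split => x /=; rewrite !in_itv /= lerNl ltrNr andbC.
by rewrite !lebesgue_measure_itv /= !lte_fin ltrN2 -!EFinB opprK addrC.
Qed.

Lemma leb_reflection (A : set R) :
  leb R ((fun x : R => (- x)%R) @^-1` A) = leb R A.
Proof.
apply/eqP; rewrite eq_le leb_reflection_le /=.
have := leb_reflection_le ((fun x : R => (- x)%R) @^-1` A).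
by congr (leb R _ <= _); apply/seteqP; split => x /=; rewrite opprK.
Qed.

(** Reflection invariance of the outer measure carries the Caratheodory splitting
    property from [A] to its reflection. *)
Lemma measurable_reflection :
  measurable_fun [set: leb_line R] ((fun x : R => (- x)%R) : leb_line R -> leb_line R).
Proof.
move=> _ A mA; rewrite setTI.
pose N (X : set R) := (fun x : R => (- x)%R) @^-1` X.
have NN Y : N (N Y) = Y by apply/seteqP; split => x; rewrite /N /= opprK.
have leb_N Y : leb R (N Y) = leb R Y by exact: leb_reflection.
have splitA X : leb R X = leb R (X `&` A) + leb R (X `&` ~` A) := mA X.
suff : forall X, leb R X = leb R (X `&` N A) + leb R (X `&` ~` N A) by [].
move=> X; rewrite -leb_N splitA -(leb_N (_ `&` A)) -(leb_N (_ `&` ~` A)).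
by rewrite -[N (N X `&` A)]/(N (N X) `&` N A)
  -[N (N X `&` ~` A)]/(N (N X) `&` ~` N A) NN.
Qed.

Lemma measurable_leb_continuous (f : R -> R) :
  continuous f -> measurable_fun [set: leb_line R] (f : leb_line R -> R).
Proof.
move=> /continuous_measurable_fun mf _ A mA; apply: sub_caratheodory.
exact: mf.
Qed.

End Reflection.

Section ReflectionIntegral.
Context {R : realType}.
Local Open Scope ereal_scope.

(** Reflection maps the completed Lebesgue measure to itself, so this is the
    change of variables formula for a pushforward. *)
Lemma ge0_integral_reflection (f : R -> \bar R) :
  measurable_fun [set: leb_line R] (f : leb_line R -> \bar R) ->
  (forall x, 0 <= f x) ->
  \int[leb R]_x f (- x)%R = \int[leb R]_x f x.
Proof.
move=> mf f0.
have /= := ge0_integral_pushforward measurable_reflection (leb R) measurableT mf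
  (fun y _ => f0 y).
rewrite preimage_setT => <-.
apply: eq_measure_integral => [|mphi A mA _]; first exact: measurable_reflection.
exact: leb_reflection.
Qed.

Lemma integrable_reflection (f : R -> \bar R) :
  (leb R).-integrable setT (f : leb_line R -> \bar R) ->
  (leb R).-integrable setT (fun x : leb_line R => f (- x)%R).
Proof.
move=> /integrableP[mf intf]; apply/integrableP; split.
  exact: (measurableT_comp mf measurable_reflection).
rewrite (ge0_integral_reflection (fun x => `|f x|))//.
exact: measurableT_comp.
Qed.

Lemma integral_reflection (f : R -> \bar R) :
  measurable_fun [set: leb_line R] (f : leb_line R -> \bar R) ->
  \int[leb R]_x f (- x)%R = \int[leb R]_x f x.
Proof.
move=> mf; rewrite integralE [RHS]integralE; congr (_ - _).
  rewrite -(ge0_integral_reflection (f^\+)); [|exact: measurable_funepos|].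
    by apply: eq_integral => x _; rewrite !funeposE.
  by move=> x; exact: funepos_ge0.
rewrite -(ge0_integral_reflection (f^\-)); [|exact: measurable_funeneg|].
  by apply: eq_integral => x _; rewrite !funenegE.
by move=> x; exact: funeneg_ge0.
Qed.

End ReflectionIntegral.

(** * Averages against a dispersal kernel *)

Definition kernel_mean {R : realType} (k f : R -> R) : R :=
  \int[leb R]_y (f y * k y).

(** The integrand is typed on [leb_line R] so that measurability refers to Lebesgue
    measurable sets, as it does for the kernel. *)
Definition has_mean {R : realType} (k f : R -> R) : Prop :=
  (leb R).-integrable setT (EFin \o (fun y : leb_line R => f y * k y)).

Section KernelMean.
Context {R : realType} {k : R -> R} (hk : dispersal_kernel k).

Lemma has_mean_dominated (f g : R -> R) : continuous f ->
  (forall y, `|f y| <= g y) -> has_mean k g -> has_mean k f.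
Proof.
rewrite /has_mean => cf fg mg.
have mfk : measurable_fun [set: leb_line R] (fun y : leb_line R => f y * k y).
  apply: measurable_funM; last exact: kernel_measurable hk.
  exact: measurable_leb_continuous.
refine (le_integrable measurableT _ _ mg).
  exact/measurable_EFinP.
move=> y _ /=; rewrite lee_fin !normrM.
rewrite ler_wpM2r//; exact: le_trans (fg y) (ler_norm _).
Qed.

Lemma has_mean_cst (a : R) : has_mean k (fun=> a).
Proof.
have /(integrableZl measurableT a) := kernel_integrable hk.
by apply: eq_integrable.
Qed.

Lemma has_mean_bounded (f : R -> R) (a : R) : continuous f ->
  (forall y, `|f y| <= a) -> has_mean k f.
Proof. by move=> cf fa; apply: has_mean_dominated (has_mean_cst a). Qed.

(** This provides integrability for every convolution occurring in the wave
    equation. *)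
Lemma has_mean_convolution (g : R -> R) (C z : R) : continuous g ->
  (forall x, 0 <= g x <= C) -> has_mean k (fun y => g (z - y)).
Proof.
move=> cg g0C; apply: (has_mean_bounded _ C).
  move=> y; apply: (@continuous_comp _ _ _ (fun y => z - y) g); last exact: cg.
  by apply: continuousB; [exact: cvg_cst|exact: cvg_id].
by move=> y; have /andP[? ?] := g0C (z - y); rewrite ger0_norm.
Qed.

Lemma has_meanD (f g : R -> R) : has_mean k f -> has_mean k g ->
  has_mean k (fun y => f y + g y).
Proof.
move=> mf mg; have := integrableD measurableT mf mg.
by apply: eq_integrable => // y _; rewrite /= mulrDl.
Qed.

Lemma has_meanZ (a : R) (f : R -> R) : has_mean k f ->
  has_mean k (fun y => a * f y).
Proof.
move=> mf; have := integrableZl measurableT a mf.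
by apply: eq_integrable => // y _; rewrite /= -mulrA.
Qed.

Lemma has_mean_reflection (f : R -> R) : has_mean k f ->
  has_mean k (fun y => f (- y)).
Proof.
move/integrable_reflection; apply: eq_integrable => // y _ /=.
by rewrite -(kernel_even hk).
Qed.

Lemma has_mean_expR (l : R) : has_mean k (fun y => expR (l * y)).
Proof.
wlog l0 : l / 0 <= l.
  move=> H; have [/H//|l0] := leP 0 l.
  have := has_mean_reflection _ (H (- l) _).
  rewrite oppr_ge0 ltW// => /(_ isT).
  by apply: eq_integrable => // y _; rewrite /= mulrNN.
apply/integrableP; split.
  apply/measurable_EFinP/measurable_funM; last exact: kernel_measurable hk.
  apply: measurable_leb_continuous => x.
  apply: continuous_comp; last exact: continuous_expR.
  exact: mulrl_continuous.
apply: le_lt_trans (kernel_exp_moment hk l0).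
rewrite le_eqVlt; apply/orP; left; apply/eqP.
apply: eq_integral => y _ /=; rewrite ger0_norm 1?mulrC//.
by rewrite mulr_ge0 ?expR_ge0 ?(kernel_ge0 hk).
Qed.

Lemma kernel_mean_cst (a : R) : kernel_mean k (fun=> a) = a.
Proof.
rewrite /kernel_mean RintegralZl//; last exact: kernel_integrable hk.
by rewrite /Rintegral kernel_mass1 // mulr1.
Qed.

Lemma kernel_meanD (f g : R -> R) : has_mean k f -> has_mean k g ->
  kernel_mean k (fun y => f y + g y) = kernel_mean k f + kernel_mean k g.
Proof.
move=> mf mg; rewrite /kernel_mean -RintegralD//.
by apply: eq_Rintegral => y _; rewrite mulrDl.
Qed.

Lemma kernel_meanZ (a : R) (f : R -> R) : has_mean k f ->
  kernel_mean k (fun y => a * f y) = a * kernel_mean k f.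
Proof.
move=> mf; rewrite /kernel_mean -RintegralZl//.
by apply: eq_Rintegral => y _; rewrite mulrA.
Qed.

Lemma ler_kernel_mean (f g : R -> R) : has_mean k f -> has_mean k g ->
  (forall y, f y <= g y) -> kernel_mean k f <= kernel_mean k g.
Proof.
move=> mf mg fg; apply: le_Rintegral => // y _.
by rewrite ler_wpM2r// (kernel_ge0 hk).
Qed.

Lemma kernel_mean_reflection (f : R -> R) : has_mean k f ->
  kernel_mean k (fun y => f (- y)) = kernel_mean k f.
Proof.
move=> /integrableP[mf _]; rewrite /kernel_mean /Rintegral.
rewrite -[in RHS](integral_reflection (EFin \o (fun y => f y * k y)))//=.
by congr fine; apply: eq_integral => y _; rewrite (kernel_even hk).
Qed.

(** By evenness the mean of exp (l y) is that of cosh (l y), which is at least 1. *)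
Lemma kernel_mean_expR_ge1 (l : R) : 1 <= kernel_mean k (fun y => expR (l * y)).
Proof.
have mE := has_mean_expR l.
have mE' := has_mean_reflection _ mE.
suff : 2 <= kernel_mean k (fun y => expR (l * y)) + kernel_mean k (fun y => expR (l * - y)).
  rewrite (kernel_mean_reflection (fun y => expR (l * y)))//; lra.
rewrite -kernel_meanD// -[leLHS]kernel_mean_cst.
apply: ler_kernel_mean => [||y]; [exact: has_mean_cst|exact: has_meanD|].
by have := expR_ge1Dx (l * y); have := expR_ge1Dx (l * - y); lra.
Qed.

Lemma linear_speed_ge0 (d : R) : 0 <= d -> 0 <= linear_speed d k.
Proof.
move=> d0; apply: lb_le_inf.
  by eexists; exists 1; [exact: ltr01|reflexivity].
move=> _ [l /= l0 <-]; apply: divr_ge0 (ltW l0); apply: ln_ge0.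
have := kernel_mean_expR_ge1 l; rewrite /kernel_mean => I1.
by rewrite -[leLHS]mulr1 ler_pM// lerDl.
Qed.

End KernelMean.

Section MeanBounds.
Context {R : realType} {k : R -> R} (hk : dispersal_kernel k).

(** Let g <= A hold beyond [M].  When [xi] is large the average sees the values of
    [g] up to [M] only through y >= xi - M.  There 1 <= exp y / (xi - M), so these
    values add at most C E / (xi - M), with [E] the first exponential moment. *)
Lemma kernel_mean_eventually_le (g : R -> R) (A C : R) : continuous g ->
  (forall x, 0 <= g x <= C) -> (\forall x \near +oo, g x <= A) ->
  forall e, 0 < e ->
    \forall xi \near +oo, kernel_mean k (fun y => g (xi - y)) <= A + e.
Proof.
move=> cg g0C [M [Mreal gA]] e e0.
have C0 : 0 <= C by have /andP[] := g0C 0; exact: le_trans.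
have A0 : 0 <= A.
  by apply: le_trans (gA (M + 1) _); [have /andP[] := g0C (M + 1)|rewrite ltrDl].
set E := kernel_mean k (fun y => expR (1 * y)).
have E1 : 1 <= E := kernel_mean_expR_ge1 hk 1.
exists (M + 1 + C * E / e); split; first exact: num_real.
move=> xi xigt.
have CEe : 0 <= C * E / e by rewrite divr_ge0 ?mulr_ge0 ?(ltW e0)//; lra.
have s0 : 0 < xi - M by lra.
have mexp := has_meanZ (C / (xi - M)) _ (has_mean_expR hk 1).
have mbound := has_meanD _ _ (has_mean_cst hk A) mexp.
have bound y : g (xi - y) <= A + C / (xi - M) * expR (1 * y).
  have /andP[g0 gC] := g0C (xi - y).
  have [yM|yM] := ltP M (xi - y).
    apply: le_trans (gA _ yM) _; rewrite lerDl.
    by rewrite mulr_ge0 ?divr_ge0 ?expR_ge0 ?(ltW s0).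
  apply: le_trans gC _; rewrite -[leLHS]add0r lerD//.
  rewrite mulrAC ler_pdivlMr// ler_wpM2l//.
  by have := expR_ge1Dx (1 * y); lra.
have mg := has_mean_convolution hk _ _ xi cg g0C.
apply: le_trans (ler_kernel_mean hk _ _ mg mbound bound) _.
rewrite (kernel_meanD _ _ (has_mean_cst hk A) mexp) (kernel_mean_cst hk).
rewrite (kernel_meanZ _ _ (has_mean_expR hk 1)) lerD2l -/E.
rewrite mulrAC ler_pdivrMr// [leRHS]mulrC -ler_pdivrMr//; lra.
Qed.

(** The upper estimate applied to [C - g]. *)
Lemma kernel_mean_eventually_ge (g : R -> R) (A C : R) : continuous g ->
  (forall x, 0 <= g x <= C) -> (\forall x \near +oo, A <= g x) ->
  forall e, 0 < e ->
    \forall xi \near +oo, A - e <= kernel_mean k (fun y => g (xi - y)).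
Proof.
move=> cg g0C gA e e0.
have cg' : continuous (fun x => C - g x).
  by move=> x; apply: continuousB; [exact: cvg_cst|exact: cg].
have g0C' x : 0 <= C - g x <= C by have := g0C x; lra.
have gA' : \forall x \near +oo, C - g x <= C - A.
  by apply: filterS gA => x ?; lra.
have := kernel_mean_eventually_le _ _ _ cg' g0C' gA' _ e0.
apply: filterS => xi.
have mg := has_mean_convolution hk _ _ xi cg g0C.
have -> : kernel_mean k (fun y => C - g (xi - y)) =
    C - kernel_mean k (fun y => g (xi - y)).
  have := kernel_meanD _ _ (has_mean_cst hk C) (has_meanZ (-1) _ mg).
  rewrite (kernel_mean_cst hk) (kernel_meanZ _ _ mg) mulN1r => <-.
  by congr kernel_mean; apply/funext => y; rewrite mulN1r.
lra.
Qed.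

End MeanBounds.

(** * Upper and lower limits at infinity *)

Section Limsup.
Context {R : realType}.

(** The finite upper limit at +oo, characterized by the two properties through which
    it enters the proof. *)
Definition eventual_sup (u : R -> R) (h : R) : Prop :=
  (forall A, (\forall x \near +oo, u x <= A) -> h <= A) /\
  (forall e, 0 < e -> \forall x \near +oo, u x <= h + e).

Definition eventual_inf (u : R -> R) (l : R) : Prop :=
  (forall A, (\forall x \near +oo, A <= u x) -> A <= l) /\
  (forall e, 0 < e -> \forall x \near +oo, l - e <= u x).

Lemma eventual_sup_exists (u : R -> R) (m M : R) :
  (forall x, m <= u x <= M) -> exists h, eventual_sup u h.
Proof.
move=> umM; pose S := [set A | \forall x \near +oo, u x <= A].
have S0 : S !=set0.
  by exists M; apply: filterE => x; have /andP[] := umM x.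
have Slb : lbound S m.
  by move=> A SA; have [x uA] := filter_ex SA; have /andP[mu _] := umM x;
    exact: le_trans uA.
exists (inf S); split => [A SA|e e0].
  by apply: ge_inf => //; exists m.
have [A SA Ae] := inf_adherent e0 (conj S0 (ex_intro _ m Slb)).
by apply: filterS SA => x uA; exact: le_trans uA (ltW Ae).
Qed.

Lemma eventual_inf_exists (u : R -> R) (m M : R) :
  (forall x, m <= u x <= M) -> exists l, eventual_inf u l.
Proof.
move=> umM; have [|h [h_le h_ge]] := eventual_sup_exists (fun x => - u x) (- M) (- m).
  by move=> x; have := umM x; lra.
exists (- h); split => [A SA|e e0].
  suff : h <= - A by lra.
  by apply: h_le; apply: filterS SA => x ?; lra.
by apply: filterS (h_ge e e0) => x ?; lra.
Qed.

Lemma eventual_inf_le_sup (u : R -> R) (l h : R) :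
  eventual_inf u l -> eventual_sup u h -> l <= h.
Proof.
move=> [_ ul] [_ uh]; apply/ler_addgt0Pr => e e0.
have e20 : 0 < e / 2 by lra.
have [x []] := filter_ex (filterI (ul _ e20) (uh _ e20)); lra.
Qed.

Lemma eventual_sup_inf_cvg (u : R -> R) (p : R) :
  eventual_inf u p -> eventual_sup u p -> u x @[x --> +oo] --> p.
Proof.
move=> [_ ul] [_ uh]; apply/cvgrPdist_le => e e0.
by apply: filterS (filterI (ul _ e0) (uh _ e0)) => x [? ?]; rewrite ler_distl; lra.
Qed.

Lemma near_pinfty_shift (P : R -> Prop) (c : R) :
  (\forall x \near +oo, P x) -> \forall x \near +oo, P (x - c).
Proof.
move=> [M [_ MP]]; exists (M + c); split; first exact: num_real.
by move=> x xM; apply: MP; rewrite ltrBrDr.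
Qed.

(** Lets the bounds obtained from [eventual_sup] and [eventual_inf] with an error [e]
    be passed to the limit as polynomial inequalities, after clearing
    denominators. *)
Lemma ler_of_small_perturbation (x y C r : R) : 0 < r ->
  (forall e, 0 < e -> e <= r -> x <= y + e * C) -> x <= y.
Proof.
move=> r0 H; apply/ler_addgt0Pr => e e0.
pose C' := `|C| + 1; have C'0 : 0 < C' by rewrite ltr_pwDr.
have [m0 [mr mC]] : 0 < Num.min r (e / C') /\
    Num.min r (e / C') <= r /\ Num.min r (e / C') <= e / C'.
  by rewrite lt_min r0 divr_gt0//= !ge_min !lexx orbT.
apply: le_trans (H _ m0 mr) _; rewrite lerD2l.
apply: (@le_trans _ _ (Num.min r (e / C') * C')).
  by rewrite ler_wpM2l ?(ltW m0)// (le_trans (ler_norm C))// lerDl.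
by rewrite -ler_pdivlMr.
Qed.

(** Subtracting the inequalities in pairs gives (1 - b1) D1 <= a1 D2 and
    (1 - b2) D2 <= a2 D1 for the oscillations D_i = h_i - l_i.  As a_i < 1 - b_i,
    the larger oscillation is at most a fraction of itself, hence zero. *)
Lemma contracting_rectangle (a1 a2 b1 b2 h1 l1 h2 l2 : R) :
  0 <= a1 -> 0 <= a2 -> 0 <= b1 -> 0 <= b2 -> a1 + b1 < 1 -> a2 + b2 < 1 ->
  l1 <= h1 -> l2 <= h2 ->
  h1 + b1 * l1 + a1 * l2 <= 1 -> 1 <= l1 + b1 * h1 + a1 * h2 ->
  h2 + b2 * l2 + a2 * l1 <= 1 -> 1 <= l2 + b2 * h2 + a2 * h1 ->
  [/\ h1 = l1, h2 = l2, l1 = pstar a1 a2 b1 b2 & l2 = qstar a1 a2 b1 b2].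
Proof.
move=> a10 a20 b10 b20 ab1 ab2 lh1 lh2 H1 H2 H3 H4.
have D1 : (1 - b1) * (h1 - l1) <= a1 * (h2 - l2) by nra.
have D2 : (1 - b2) * (h2 - l2) <= a2 * (h1 - l1) by nra.
have [E1 E2] : h1 - l1 = 0 /\ h2 - l2 = 0.
  have [le12|/ltW le21] := leP (h2 - l2) (h1 - l1).
    have : (1 - b1 - a1) * (h1 - l1) <= 0 by nra.
    rewrite pmulr_rle0; [|by lra]; lra.
  have : (1 - b2 - a2) * (h2 - l2) <= 0 by nra.
  rewrite pmulr_rle0; [|by lra]; lra.
have e1 : h1 = l1 by lra.
have e2 : h2 = l2 by lra.
subst h1 h2.
have F1 : (1 + b1) * l1 + a1 * l2 = 1 by lra.
have F2 : (1 + b2) * l2 + a2 * l1 = 1 by lra.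
have det : 0 < (1 + b1) * (1 + b2) - a1 * a2 by nra.
have det0 : (1 + b1) * (1 + b2) - a1 * a2 != 0 by rewrite gt_eqF.
split => //; rewrite /pstar /qstar; apply: (mulIf det0); rewrite divfK//.
  transitivity ((1 + b2) * ((1 + b1) * l1 + a1 * l2) - a1 * ((1 + b2) * l2 + a2 * l1));
    first by ring.
  by rewrite F1 F2; ring.
transitivity ((1 + b1) * ((1 + b2) * l2 + a2 * l1) - a2 * ((1 + b1) * l1 + a1 * l2));
  first by ring.
by rewrite F1 F2; ring.
Qed.

End Limsup.

(** * Tent functions as approximate eigenfunctions of dispersal *)

Section Tent.
Context {R : realType}.

Definition tent (L x : R) : R := Num.max 0 (L - `|x|).

Lemma tent_ge0 (L x : R) : 0 <= tent L x.
Proof. by rewrite /tent le_max lexx. Qed.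

Lemma tent_le (L x : R) : 0 <= L -> tent L x <= L.
Proof. by move=> L0; rewrite /tent ge_max L0 gerBl normr_ge0. Qed.

Lemma tent_continuous (L : R) : continuous (tent L).
Proof.
move=> x; apply: (@continuous_max R R (fun=> 0) (fun x => L - `|x|)); first exact: cvg_cst.
apply: continuousB; first exact: cvg_cst.
exact: norm_continuous.
Qed.

(** Inside [-L, L] the tent is L - |.|, which is a lower bound for it everywhere.  As
    |x - y| + |x + y| = 2 max (|x|, |y|), a loss occurs only if |y| >= |x|, near the
    apex, and there the right-hand side is still at least 2 (L - |y|) >= 2 s L. *)
Lemma tent_almost_midconcave (s L x y : R) : 0 <= s <= 1 -> 0 < L ->
  `|y| <= (1 - s) * L -> 2 * s * tent L x <= tent L (x - y) + tent L (x + y).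
Proof.
move=> /andP[s0 s1] L0 yB.
have [Lx|xL] := leP L `|x|.
  rewrite (_ : tent L x = 0) ?mulr0 ?addr_ge0 ?tent_ge0//.
  by apply/max_idPl; rewrite subr_le0.
have -> : tent L x = L - `|x| by apply/max_idPr; rewrite subr_ge0 ltW.
have t1 : L - `|x - y| <= tent L (x - y) by rewrite /tent le_max lexx orbT.
have t2 : L - `|x + y| <= tent L (x + y) by rewrite /tent le_max lexx orbT.
apply: le_trans (lerD t1 t2).
have p : 0 <= (1 - s) * (L - `|x|) by rewrite mulr_ge0; lra.
have q : 0 <= s * `|x| by rewrite mulr_ge0.
have [] : `|x - y| + `|x + y| = 2 * `|x| \/ `|x - y| + `|x + y| = 2 * `|y|.
- have [x0|x0] := ger0P x; have [y0|y0] := ger0P y;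
  have [m0|m0] := ger0P (x - y); have [q0|q0] := ger0P (x + y);
  first [left; lra | right; lra].
- lra.
- lra.
Qed.

Context {k : R -> R} (hk : dispersal_kernel k).
Let E := kernel_mean k (fun y => expR (1 * y)).

Lemma has_mean_tent (L x : R) : 0 <= L -> has_mean k (fun y => tent L (x - y)).
Proof.
move=> L0; apply: (has_mean_convolution hk _ L); first exact: tent_continuous.
by move=> y; rewrite tent_ge0 tent_le.
Qed.

(** Evenness turns the mean of the tent into that of its symmetrization, for which the
    preceding inequality holds pointwise when |y| <= (1 - s) L.  For larger |y|
    the factor 1 - (exp y + exp (- y)) / ((1 - s) L) is not positive, so including it
    makes the lower bound valid for all [y]; it integrates to the factor in the
    statement. *)
Lemma kernel_mean_tent (s L x : R) : 0 <= s < 1 -> 0 < L ->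
  s * (1 - 2 * E / ((1 - s) * L)) * tent L x <=
    kernel_mean k (fun y => tent L (x - y)).
Proof.
move=> /andP[s0 s1] L0; set B := (1 - s) * L.
have B0 : 0 < B by rewrite mulr_gt0//; lra.
have mT := has_mean_tent L x (ltW L0).
have mT' : has_mean k (fun y => tent L (x + y)).
  have := has_mean_reflection hk _ mT.
  by congr has_mean; apply/funext => y; rewrite opprK.
have mexp := has_mean_expR hk 1.
have mexp' := has_mean_reflection hk _ mexp.
have mee := has_meanZ (- (2 * s * tent L x / B)) _ (has_meanD _ _ mexp mexp').
have mlow := has_meanD _ _ (has_mean_cst hk (2 * s * tent L x)) mee.
have mTT := has_meanD _ _ mT mT'.
have low y : 2 * s * tent L x + - (2 * s * tent L x / B) *
    (expR (1 * y) + expR (1 * - y)) <= tent L (x - y) + tent L (x + y).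
  have t0 : 0 <= 2 * s * tent L x.
    by rewrite mulr_ge0 ?tent_ge0 ?mulr_ge0.
  have e0 := expR_gt0 (1 * y); have e0' := expR_gt0 (1 * - y).
  have [yB|By] := leP `|y| B.
    apply: le_trans (tent_almost_midconcave s L x y _ L0 yB); last lra.
    by rewrite mulNr gerBl mulr_ge0 ?divr_ge0 ?(ltW B0)//; lra.
  have eB : B <= expR (1 * y) + expR (1 * - y).
    have := expR_ge1Dx (1 * y); have := expR_ge1Dx (1 * - y).
    by have [?|?] := lerP 0 y; [rewrite ger0_norm in By|rewrite ltr0_norm in By]; lra.
  apply: le_trans (addr_ge0 (tent_ge0 L _) (tent_ge0 L _)).
  rewrite mulNr subr_le0 [leRHS]mulrAC ler_pdivlMr// ler_wpM2l//.
have := ler_kernel_mean hk _ _ mlow mTT low.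
rewrite (kernel_meanD _ _ mT mT') (kernel_meanD _ _ (has_mean_cst hk _) mee).
rewrite (kernel_mean_cst hk) (kernel_meanZ _ _ (has_meanD _ _ mexp mexp')).
rewrite (kernel_meanD _ _ mexp mexp').
rewrite (kernel_mean_reflection hk (fun y => expR (1 * y)) mexp) -/E.
have -> : kernel_mean k (fun y => tent L (x + y)) =
    kernel_mean k (fun y => tent L (x - y)).
  rewrite -(kernel_mean_reflection hk _ mT).
  by congr kernel_mean; apply/funext => y; rewrite opprK.
set K := kernel_mean _ _.
have -> : 2 * s * tent L x + - (2 * s * tent L x / B) * (E + E) =
  2 * (s * (1 - 2 * E / B) * tent L x) by field; rewrite gt_eqF.
lra.
Qed.

End Tent.

(** * One equation of the wave system *)

(** Density after reproduction and before dispersal: the integrand of the wave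
    equation without its kernel. *)
Definition growth {R : realType} (d a b c : R) (u v : R -> R) (x : R) : R :=
  (1 + d) * u x / (1 + d * (u x + b * u (x - c) + a * v x)).

Section Wave.
Context {R : realType} {d a b c : R} {k u v : R -> R}.
Context (hk : dispersal_kernel k).
Context (a_ge0 : 0 <= a) (b_ge0 : 0 <= b) (ab_lt1 : a + b < 1).
Context (d_gt0 : 0 < d) (c_gt0 : 0 < c).
Context (u_cont : continuous u) (v_cont : continuous v).
Context (u_bnd : forall x, 0 < u x < 1) (v_bnd : forall x, 0 < v x < 1).
Context (u_eq : wave_equation d a b k c u v).

Let G := growth d a b c u v.

Lemma wave_kernel_mean xi : u (xi + c) = kernel_mean k (fun y => G (xi - y)).
Proof. by have := congr1 fine (u_eq xi). Qed.

Lemma growth_den_ge1 x : 1 <= 1 + d * (u x + b * u (x - c) + a * v x).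
Proof.
have /andP[u0 _] := u_bnd x; have /andP[w0 _] := u_bnd (x - c).
have /andP[v0 _] := v_bnd x.
by rewrite lerDl mulr_ge0 ?(ltW d_gt0)// !addr_ge0 ?mulr_ge0 ?(ltW u0) ?(ltW w0) ?(ltW v0).
Qed.

Lemma growth_bounds x : 0 <= G x <= 1 + d.
Proof.
have D1 := growth_den_ge1 x; have D0 := lt_le_trans ltr01 D1.
have /andP[u0 u1] := u_bnd x.
have d1 : 0 <= 1 + d by rewrite addr_ge0 ?(ltW d_gt0).
rewrite /G /growth divr_ge0 ?mulr_ge0 ?(ltW u0) ?(ltW D0)//=.
rewrite ler_pdivrMr// ler_wpM2l//; exact: le_trans (ltW u1) D1.
Qed.

Lemma growth_continuous : continuous G.
Proof.
have uc_cont : continuous (fun x => u (x - c)).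
  move=> x; apply: continuous_comp; last exact: u_cont.
  by apply: continuousB; [exact: cvg_id|exact: cvg_cst].
have den_cont : continuous (fun x => 1 + d * (u x + b * u (x - c) + a * v x)).
  move=> x; apply: cvgD; first exact: cvg_cst.
  apply: cvgMr; apply: cvgD; last by apply: cvgMr; exact: v_cont.
  by apply: cvgD; [exact: u_cont|apply: cvgMr; exact: uc_cont].
move=> x; apply: cvgM; first by apply: cvgMr; exact: u_cont.
apply: cvgV; last exact: den_cont.
by rewrite gt_eqF// (lt_le_trans ltr01 (growth_den_ge1 x)).
Qed.

Let theta := (1 + d * ((1 + (a + b)) / 2)) / (1 + d).

(** Since u (x - c) and v x are below 1, the denominator is at most
    1 + d (u x + a + b); the resulting lower bound increases with u x, and for
    u x = s <= (1 - (a + b)) / 2 it is at least s / theta.  Any threshold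
    below 1 - (a + b), the equilibrium of this lower equation, would give
    theta < 1; the midpoint is taken. *)
Lemma growth_superlinear x s : 0 <= s -> s <= (1 - (a + b)) / 2 -> s <= u x ->
  s <= theta * G x.
Proof.
have [a0 b0 ab1 d0] : [/\ 0 <= a, 0 <= b, a + b < 1 & 0 < d] by [].
move=> s0 s_small su; have /andP[u0 u1] := u_bnd x.
have /andP[w0 w1] := u_bnd (x - c); have /andP[v0 v1] := v_bnd x.
have D1 := growth_den_ge1 x; rewrite /theta /G /growth.
set D := 1 + d * (u x + _ + _) in D1 *.
have d1 : 0 < 1 + d by rewrite addr_gt0.
have -> : (1 + d * ((1 + (a + b)) / 2)) / (1 + d) * ((1 + d) * u x / D) =
    (1 + d * ((1 + (a + b)) / 2)) * u x / D.
  by field; rewrite !gt_eqF// (lt_le_trans ltr01).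
rewrite ler_pdivlMr ?(lt_le_trans ltr01)//.
have bw : b * u (x - c) <= b by rewrite ler_piMr// ltW.
have av : a * v x <= a by rewrite ler_piMr// ltW.
apply: (@le_trans _ _ (s * (1 + d * (u x + b + a)))).
  by rewrite ler_wpM2l// /D lerD2l ler_wpM2l ?(ltW d_gt0)//; lra.
have -> : s * (1 + d * (u x + b + a)) = s + d * (s * u x + s * (a + b)) by ring.
have -> : (1 + d * ((1 + (a + b)) / 2)) * u x =
  u x + d * ((1 - (a + b)) / 2 * u x + (a + b) * u x) by field.
rewrite lerD// ler_wpM2l ?(ltW d_gt0)// lerD//.
  by rewrite ler_wpM2r// ltW.
by rewrite mulrC ler_wpM2l ?addr_ge0.
Qed.

(** Persistence.  With theta <= s ^ 2 and a tent wide enough for the tail loss in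
    [kernel_mean_tent] to be at most 1 - s, a dispersal step multiplies the tent by
    at least theta, and the growth step makes up for this.  A small multiple of the
    tent is therefore a subsolution in the moving frame. *)
Lemma wave_bounded_below : exists2 m : R, 0 < m & forall x, 0 <= x -> m <= u x.
Proof.
have [a0 b0 ab1 d0] : [/\ 0 <= a, 0 <= b, a + b < 1 & 0 < d] by [].
have d1 : 0 < 1 + d by rewrite addr_gt0.
have theta0 : 0 < theta.
  by rewrite divr_gt0// addr_gt0// mulr_gt0// divr_gt0// ltr_wpDr// addr_ge0.
have theta1 : theta < 1.
  rewrite ltr_pdivrMr// mul1r ltrD2l -[ltRHS]mulr1 ltr_pM2l//; lra.
(* By AM-GM this [s] satisfies theta <= s ^ 2. *)
pose s := (1 + theta) / 2.
have s01 : 0 <= s < 1 by rewrite /s; lra.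
have s_theta : theta <= s * s by rewrite /s; nra.
pose E := kernel_mean k (fun y => expR (1 * y)).
have E1 : 1 <= E := kernel_mean_expR_ge1 hk 1.
(* The first term makes the tail loss 2 E / ((1 - s) L) at most 1 - s; the second
   makes the tent positive on [0, c]. *)
pose L := 2 * E / (1 - s) ^+ 2 + c.
have sB : 0 < 1 - s by lra.
have L_c : c < L by rewrite ltrDr divr_gt0 ?exprn_gt0//; lra.
have L0 : 0 < L by exact: lt_trans L_c.
have tail : 2 * E / ((1 - s) * L) <= 1 - s.
  rewrite ler_pdivrMr ?mulr_gt0// mulrA -expr2 [leRHS]mulrC -ler_pdivrMr ?exprn_gt0//.
  by rewrite lerDl; exact: ltW.
have tent_sub x : theta * tent L x <= kernel_mean k (fun y => tent L (x - y)).
  apply: le_trans (kernel_mean_tent hk s L x s01 L0).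
  rewrite ler_wpM2r ?tent_ge0// (le_trans s_theta)// ler_wpM2l//.
    by case/andP: s01.
  by rewrite lerBrDr -lerBrDl.
have [||x0 _ umin] := @EVT_min R u (- L) L.
- lra.
- exact: continuous_subspaceT.
have /andP[mu0 _] := u_bnd x0; set mu := u x0 in mu0 umin.
pose eta := (1 - (a + b)) / 2; have eta0 : 0 < eta by rewrite /eta; lra.
pose delta := Num.min mu eta / L.
have min0 : 0 < Num.min mu eta by rewrite lt_min mu0.
have delta0 : 0 < delta by rewrite divr_gt0.
have dt_le x : delta * tent L x <= Num.min mu eta.
  by rewrite mulrAC ler_pdivrMr// ler_wpM2l ?(ltW min0)// tent_le// ltW.
have u_tent (n : nat) x : delta * tent L x <= u (x + n%:R * c).
  elim: n x => [|n IH] x.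
    rewrite mul0r addr0; have [xL|Lx] := leP `|x| L.
      apply: le_trans (dt_le x) _; rewrite ge_min; apply/orP; left.
      by apply: umin; rewrite in_itv /= -ler_norml.
    rewrite (_ : tent L x = 0) ?mulr0; first by have /andP[/ltW] := u_bnd x.
    by apply/max_idPl; rewrite subr_le0 ltW.
  have -> : x + n.+1%:R * c = (x + n%:R * c) + c by rewrite -natr1; ring.
  rewrite wave_kernel_mean.
  have mt := has_mean_tent hk L x (ltW L0).
  have mG := has_mean_convolution hk _ _ (x + n%:R * c)
    growth_continuous growth_bounds.
  rewrite -(ler_pM2l theta0) -(kernel_meanZ _ _ mG).
  apply: (@le_trans _ _ (kernel_mean k (fun y => delta * tent L (x - y)))).
    by rewrite (kernel_meanZ _ _ mt) mulrCA ler_pM2l.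
  apply: (ler_kernel_mean hk _ _ (has_meanZ _ _ mt) (has_meanZ _ _ mG)) => y.
  apply: growth_superlinear; first by rewrite mulr_ge0 ?tent_ge0 ?ltW.
    by apply: le_trans (dt_le _) _; rewrite ge_min lexx orbT.
  by have -> : x + n%:R * c - y = x - y + n%:R * c by ring.
exists (delta * (L - c)); first by rewrite mulr_gt0// subr_gt0.
move=> x x_ge0; pose n := Num.trunc (x / c).
have /andP[] := truncn_itv (divr_ge0 x_ge0 (ltW c_gt0)).
rewrite -/n ler_pdivlMr// ltr_pdivrMr// -natr1 => nx xn.
have -> : x = (x - n%:R * c) + n%:R * c by ring.
apply: le_trans (u_tent n _); rewrite ler_wpM2l ?(ltW delta0)//.
rewrite /tent le_max ger0_norm ?subr_ge0//; apply/orP; right; lra.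
Qed.

Context {h l h' l' : R}.
Context (u_sup : eventual_sup u h) (u_inf : eventual_inf u l).
Context (v_sup : eventual_sup v h') (v_inf : eventual_inf v l').
Context (l_gt0 : 0 < l) (l'_gt0 : 0 < l').

(** Replace u by h + e and the two inhibiting densities by their lower limits minus
    [e]: this bounds [growth] eventually, hence its average, hence [h].  Letting
    [e] tend to 0 and dividing by h > 0 gives the claim. *)
Lemma wave_sup_le : h + b * l + a * l' <= 1.
Proof.
have [a0 b0 ab1 d0] : [/\ 0 <= a, 0 <= b, a + b < 1 & 0 < d] by [].
have [l0 l'0] : 0 < l /\ 0 < l' by [].
have lh : l <= h := eventual_inf_le_sup _ _ _ u_inf u_sup.
have h0 : 0 < h := lt_le_trans l_gt0 lh.
pose D := 1 + d * (h + b * l + a * l').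
have bl : 0 <= b * l by rewrite mulr_ge0// ltW.
have al : 0 <= a * l' by rewrite mulr_ge0// ltW.
suff : h * D <= (1 + d) * h.
  rewrite mulrC ler_pM2r// lerD2l -[leRHS]mulr1 ler_pM2l//.
have r0 : 0 < Num.min l l' by rewrite lt_min l_gt0.
apply: (@ler_of_small_perturbation _ _ _ (1 + d + D) _ r0) => e e0.
rewrite le_min => /andP[el el'].
have Dpos : 0 < D by rewrite /D addr_gt0// mulr_gt0//; lra.
pose De := 1 + d * ((h + e) + b * (l - e) + a * (l' - e)).
(* The error enters De with coefficient d * (1 - (a + b)) >= 0, so that D may
   replace De at the end. *)
have DDe : D <= De by rewrite /D /De lerD2l ler_pM2l//; nra.
have De0 : 0 < De := lt_le_trans Dpos DDe.
have nearG : \forall x \near +oo, G x <= (1 + d) * (h + e) / De.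
  have [_ /(_ _ e0) n1] := u_sup; have [_ /(_ _ e0) n2] := u_inf.
  have [_ /(_ _ e0) n3] := v_inf.
  have n2' := near_pinfty_shift _ c n2.
  apply: filterS (filterI n1 (filterI n2' n3)) => x [/= U1 [/= U2 U3]].
  have /andP[ux0 ux1] := u_bnd x.
  have W0 : 0 <= b * (l - e) + a * (l' - e).
    by rewrite addr_ge0// mulr_ge0// subr_ge0.
  have W1 : b * (l - e) <= b * u (x - c) by rewrite ler_wpM2l.
  have W2 : a * (l' - e) <= a * v x by rewrite ler_wpM2l.
  apply: (@le_trans _ _ ((1 + d) * u x / (1 + d * (u x + (b * (l - e) + a * (l' - e)))))).
    rewrite ler_wpM2l ?mulr_ge0 ?(ltW ux0)//; first by rewrite addr_ge0 ?ltW.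
    rewrite lef_pV2 ?posrE; last 2 first.
    - exact: lt_le_trans (growth_den_ge1 x).
    - by rewrite addr_gt0// mulr_gt0// ltr_wpDr.
    by rewrite lerD2l ler_pM2l//; lra.
  rewrite ler_pdivrMr; last by rewrite addr_gt0// mulr_gt0// ltr_wpDr.
  rewrite mulrAC ler_pdivlMr// -!mulrA ler_pM2l ?addr_gt0//.
  set w := b * (l - e) + a * (l' - e) in W0 *.
  have -> : De = 1 + d * (h + e + w) by rewrite /De /w; ring.
  rewrite -subr_ge0.
  have -> : (h + e) * (1 + d * (u x + w)) - u x * (1 + d * (h + e + w)) =
    (h + e - u x) * (1 + d * w) by ring.
  by rewrite mulr_ge0 ?subr_ge0// addr_ge0// mulr_ge0// ltW.
have := kernel_mean_eventually_le hk _ _ _ growth_continuous growth_bounds nearG _ e0.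
move=> /(near_pinfty_shift _ c) nearu.
have [/(_ ((1 + d) * (h + e) / De + e)) uh _] := u_sup.
have {uh} : h <= (1 + d) * (h + e) / De + e.
  apply: uh; apply: filterS nearu => x.
  by rewrite -wave_kernel_mean subrK.
rewrite -lerBlDr ler_pdivlMr// => hDe.
have [he|he] := leP (h - e) 0.
  have : (h - e) * D <= 0 by rewrite mulr_le0_ge0 ?(ltW Dpos).
  have : 0 <= (1 + d) * (h + e) by rewrite mulr_ge0// addr_ge0 ?(ltW d_gt0)// ltW.
  lra.
have : (h - e) * D <= (h - e) * De by rewrite ler_pM2l.
lra.
Qed.

(** Dual of [wave_sup_le]: here the positivity of the lower limit [l] is what allows
    the division. *)
Lemma wave_inf_ge : 1 <= l + b * h + a * h'.
Proof.
have [a0 b0 ab1 d0] : [/\ 0 <= a, 0 <= b, a + b < 1 & 0 < d] by [].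
have [l0 l'0] : 0 < l /\ 0 < l' by [].
have lh : l <= h := eventual_inf_le_sup _ _ _ u_inf u_sup.
have lh' : l' <= h' := eventual_inf_le_sup _ _ _ v_inf v_sup.
have h0 : 0 < h := lt_le_trans l_gt0 lh.
have h'0 : 0 < h' := lt_le_trans l'_gt0 lh'.
pose D := 1 + d * (l + b * h + a * h').
have bh : 0 <= b * h by rewrite mulr_ge0// ltW.
have ah : 0 <= a * h' by rewrite mulr_ge0// ltW.
suff : (1 + d) * l <= l * D.
  rewrite [leRHS]mulrC ler_pM2r// lerD2l -[leLHS]mulr1 ler_pM2l//.
apply: (@ler_of_small_perturbation _ _ _ (1 + d + D) _ l_gt0) => e e0 el.
have Dpos : 0 < D by rewrite /D addr_gt0// mulr_gt0//; lra.
have le0 : 0 <= l - e by rewrite subr_ge0.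
pose w := b * (h + e) + a * (h' + e).
have w0 : 0 <= w by rewrite addr_ge0// mulr_ge0// addr_ge0// ltW.
pose De := 1 + d * (l - e + w).
have De0 : 0 < De by rewrite /De ltr_wpDr// mulr_ge0 ?(ltW d_gt0)// addr_ge0.
have DeD : De <= D by rewrite /D /De /w lerD2l ler_pM2l//; nra.
have nearG : \forall x \near +oo, (1 + d) * (l - e) / De <= G x.
  have [_ /(_ _ e0) n1] := u_inf; have [_ /(_ _ e0) n2] := u_sup.
  have [_ /(_ _ e0) n3] := v_sup.
  have n2' := near_pinfty_shift _ c n2.
  apply: filterS (filterI n1 (filterI n2' n3)) => x [/= U1 [/= U2 U3]].
  have /andP[ux0 ux1] := u_bnd x.
  have W1 : b * u (x - c) <= b * (h + e) by rewrite ler_wpM2l.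
  have W2 : a * v x <= a * (h' + e) by rewrite ler_wpM2l.
  have duw : 0 < 1 + d * (u x + w) by rewrite addr_gt0// mulr_gt0// ltr_wpDr.
  apply: (@le_trans _ _ ((1 + d) * u x / (1 + d * (u x + w)))); last first.
    rewrite ler_wpM2l ?mulr_ge0 ?(ltW ux0)//; first by rewrite addr_ge0 ?ltW.
    rewrite lef_pV2 ?posrE//; last exact: lt_le_trans (growth_den_ge1 x).
    by rewrite lerD2l ler_pM2l// /w; lra.
  rewrite ler_pdivlMr// mulrAC ler_pdivrMr// -!mulrA ler_pM2l ?addr_gt0//.
  rewrite /De -subr_ge0.
  have -> : u x * (1 + d * (l - e + w)) - (l - e) * (1 + d * (u x + w)) =
    (u x - (l - e)) * (1 + d * w) by ring.
  by rewrite mulr_ge0 ?subr_ge0// addr_ge0// mulr_ge0// ltW.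
have := kernel_mean_eventually_ge hk _ _ _ growth_continuous growth_bounds nearG _ e0.
move=> /(near_pinfty_shift _ c) nearu.
have [/(_ ((1 + d) * (l - e) / De - e)) ul _] := u_inf.
have {ul} : (1 + d) * (l - e) / De - e <= l.
  apply: ul; apply: filterS nearu => x.
  by rewrite -wave_kernel_mean subrK.
rewrite lerBlDr ler_pdivrMr// => lDe.
have : (l + e) * De <= (l + e) * D by rewrite ler_pM2l// addr_gt0.
lra.
Qed.

End Wave.

(** * Convergence to the coexistence state *)

Lemma unif_continuous_continuous {U V : uniformType} (f : U -> V) :
  unif_continuous f -> continuous f.
Proof.
move=> fu x; apply/cvg_entourageP => A entA.
by have /(nbhs_entourage x) := fu _ entA; apply: filterS => y; rewrite /xsection /= inE.
Qed.

Theorem theorem5p9 (R : realType)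
    (a1 a2 b1 b2 d1 d2 : R) (k1 k2 : R -> R) (c : R) (rho varrho : R -> R)
    (a1_ge0 : 0 <= a1) (a2_ge0 : 0 <= a2)
    (b1_ge0 : 0 <= b1) (b2_ge0 : 0 <= b2)
    (d1_gt0 : 0 < d1) (d2_gt0 : 0 < d2)
    (a2_lt : a2 < 1 + b1) (a1_lt : a1 < 1 + b2)
    (k1_kernel : dispersal_kernel k1) (k2_kernel : dispersal_kernel k2)
    (c_gt : cstar d1 d2 k1 k2 < c)
    (wave_BUC :
       bounded_unif_continuous (fun xi : R => (rho xi, varrho xi) : R * R))
    (rho_eq : wave_equation d1 a1 b1 k1 c rho varrho)
    (varrho_eq : wave_equation d2 a2 b2 k2 c varrho rho)
    (rho_bounds : forall xi : R, 0 < rho xi < 1)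
    (varrho_bounds : forall xi : R, 0 < varrho xi < 1)
    (ab1_lt1 : a1 + b1 < 1) (ab2_lt1 : a2 + b2 < 1) :
  ((rho xi, varrho xi) : R * R) @[xi --> +oo] -->
    ((pstar a1 a2 b1 b2, qstar a1 a2 b1 b2) : R * R).
Proof.
have c_gt0 : 0 < c.
  apply: le_lt_trans c_gt; rewrite /cstar le_max.
  by rewrite (linear_speed_ge0 k1_kernel)// ltW.
have wave_cont := unif_continuous_continuous _ wave_BUC.2.
have rho_cont : continuous rho.
  by move=> x; apply: (cvg_comp _ _ (wave_cont x)
    (cvg_fst (F := nbhs (rho x)) (G := nbhs (varrho x)))).
have varrho_cont : continuous varrho.
  by move=> x; apply: (cvg_comp _ _ (wave_cont x)
    (cvg_snd (F := nbhs (rho x)) (G := nbhs (varrho x)))).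
have le01 (u : R -> R) : (forall x, 0 < u x < 1) -> forall x, 0 <= u x <= 1.
  by move=> u01 x; have /andP[/ltW-> /ltW->] := u01 x.
have [h1 rho_sup] := eventual_sup_exists _ _ _ (le01 _ rho_bounds).
have [l1 rho_inf] := eventual_inf_exists _ _ _ (le01 _ rho_bounds).
have [h2 varrho_sup] := eventual_sup_exists _ _ _ (le01 _ varrho_bounds).
have [l2 varrho_inf] := eventual_inf_exists _ _ _ (le01 _ varrho_bounds).
have inf_gt0 (u : R -> R) l : eventual_inf u l ->
    (exists2 m : R, 0 < m & forall x, 0 <= x -> m <= u x) -> 0 < l.
  move=> [l_max _] [m m0 mu]; apply: lt_le_trans m0 _; apply: l_max.
  by exists 0; split => // x /ltW /mu.
have l1_gt0 : 0 < l1.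
  apply: inf_gt0 rho_inf _.
  exact: (wave_bounded_below k1_kernel a1_ge0 b1_ge0 ab1_lt1 d1_gt0 c_gt0
    rho_cont varrho_cont rho_bounds varrho_bounds rho_eq).
have l2_gt0 : 0 < l2.
  apply: inf_gt0 varrho_inf _.
  exact: (wave_bounded_below k2_kernel a2_ge0 b2_ge0 ab2_lt1 d2_gt0 c_gt0
    varrho_cont rho_cont varrho_bounds rho_bounds varrho_eq).
have H1 := wave_sup_le k1_kernel a1_ge0 b1_ge0 ab1_lt1 d1_gt0
  rho_cont varrho_cont rho_bounds varrho_bounds rho_eq
  rho_sup rho_inf varrho_inf l1_gt0 l2_gt0.
have H2 := wave_inf_ge k1_kernel a1_ge0 b1_ge0 ab1_lt1 d1_gt0
  rho_cont varrho_cont rho_bounds varrho_bounds rho_eq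
  rho_sup rho_inf varrho_sup varrho_inf l1_gt0 l2_gt0.
have H3 := wave_sup_le k2_kernel a2_ge0 b2_ge0 ab2_lt1 d2_gt0
  varrho_cont rho_cont varrho_bounds rho_bounds varrho_eq
  varrho_sup varrho_inf rho_inf l2_gt0 l1_gt0.
have H4 := wave_inf_ge k2_kernel a2_ge0 b2_ge0 ab2_lt1 d2_gt0
  varrho_cont rho_cont varrho_bounds rho_bounds varrho_eq
  varrho_sup varrho_inf rho_sup rho_inf l2_gt0 l1_gt0.
have [h1E h2E l1E l2E] := contracting_rectangle a1 a2 b1 b2 h1 l1 h2 l2
  a1_ge0 a2_ge0 b1_ge0 b2_ge0 ab1_lt1 ab2_lt1
  (eventual_inf_le_sup _ _ _ rho_inf rho_sup)
  (eventual_inf_le_sup _ _ _ varrho_inf varrho_sup) H1 H2 H3 H4.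
subst h1 h2 l1 l2.
exact: (cvg_pair (eventual_sup_inf_cvg _ _ rho_inf rho_sup)
  (eventual_sup_inf_cvg _ _ varrho_inf varrho_sup)).
Qed.
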